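(* Let $p\in\mathbb R[x_1,x_2,x_3,x_4,u]$ be the Choi–Lam form viewed as a form of degree $4$ in five variables: $$p=x_1^2x_2^2+x_1^2x_3^2+x_2^2x_3^2+x_4^4-4x_1x_2x_3x_4 .$$ Then $p_{\min}=0$ and $p_{\min}-\mathrm{sp}_r(p)=|\mathrm{sp}_r(p)|=\Omega(1/r^2)$, i.e., there exist $c>0$ and $r_0\ge2$ such that $p_{\min}-\mathrm{sp}_r(p)\ge c/r^2$ for all integers $r\ge r_0$.
   Context: The spectral bounds are taken with $n=5$ variables and $d=2$. In general, $R_{2d}$ is the space of real homogeneous polynomials of degree $2d$ in $n$ variables $x$; $s$ is the sum of squares of all $n$ variables (here $s=x_1^2+x_2^2+x_3^2+x_4^2+u^2$); $p_{\min}$ is the minimum of $p$ on the unit sphere of $\mathbb R^n$. Let $[n]=\{1,\dots,n\}$. A matrix $A\in\mathbb R^{[n]^d\times[n]^d}$ is maximally symmetric if, viewed as a $2d$-tensor with entries $A_{\underline i,\underline j}$ at position $\underline i\,\underline j\in[n]^{2d}$, it is invariant under all permutations of the $2d$ indices. Every $f\in R_{2d}$ has a unique maximally symmetric matrix $\mathrm{MaxSym}(f)\in\mathbb R^{[n]^d\times[n]^d}$ with $f(x)=\langle\mathrm{MaxSym}(f),(xx^T)^{\otimes d}\rangle$ (trace inner product). Set $Q(p)=\mathrm{MaxSym}(p)$ and $M=\mathrm{MaxSym}(s^d)$. Let $\Pi_r$ be the orthogonal projection of $(\mathbb R^n)^{\otimes r}$ onto the subspace $S^r(\mathbb R^n)$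 of symmetric $r$-tensors. For $r\ge d$ set $Q_r(p)=\Pi_r(Q(p)\otimes I_n^{\otimes(r-d)})\Pi_r$ and $M_r=\Pi_r(M\otimes I_n^{\otimes(r-d)})\Pi_r$. The spectral bound is $\mathrm{sp}_r(p)=\max\{\nu\in\mathbb R: Q_r(p)-\nu M_r\succeq0\}=\min\{v^TQ_r(p)v: v\in S^r(\mathbb R^n),\,v^TM_rv=1\}$. *)

(* Defs.v *)
From HB Require Import structures.
From mathcomp Require Import all_boot all_order all_algebra all_fingroup.
From mathcomp Require Import mpoly.
From mathcomp Require Import boolp classical_sets reals.

Set Implicit Arguments.
Unset Strict Implicit.
Unset Printing Implicit Defensive.

Import Order.TTheory GRing.Theory Num.Theory.
Local Open Scope ring_scope.
Local Open Scope classical_set_scope.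

(* [n]^r. *)
Definition mindex (n r : nat) : finType := {ffun 'I_r -> 'I_n}.

(* (R^n)^{⊗r} is 'cV[R]_(tdim n r): coordinates are numbered by the library
   enumeration of [n]^r, through which all entries below are addressed. *)
Definition tdim (n r : nat) : nat := #|mindex n r|.

(* A multi-index of [n]^(d+k) is the concatenation of its first d and its
   last k entries. *)
Definition mi_left (n d k : nat) (i : mindex n (d + k)) : mindex n d :=
  [ffun a => i (lshift k a)].
Definition mi_right (n d k : nat) (i : mindex n (d + k)) : mindex n k :=
  [ffun b => i (rshift d b)].
Definition mi_perm (n r : nat) (i : mindex n r) (sigma : 'S_r) : mindex n r :=
  [ffun a => i (sigma a)].

Section Tensors.
Variable R : realType.
Variable n : nat.

Definition tentry (r : nat) (v : 'cV[R]_(tdim n r)) (i : mindex n r) : R :=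
  v (enum_rank i) 0.

Definition tmx_entry (r : nat) (A : 'M[R]_(tdim n r)) (i j : mindex n r) : R :=
  A (enum_rank i) (enum_rank j).

Definition tmx (r : nat) (F : mindex n r -> mindex n r -> R) :
    'M[R]_(tdim n r) :=
  \matrix_(a, b) F (enum_val a) (enum_val b).

(* Kronecker product A ⊗ B. *)
Definition tprod (d k : nat) (A : 'M[R]_(tdim n d)) (B : 'M[R]_(tdim n k)) :
    'M[R]_(tdim n (d + k)) :=
  tmx (fun i j => tmx_entry A (mi_left i) (mi_left j) *
                  tmx_entry B (mi_right i) (mi_right j)).

(* Kronecker power A^{⊗r}. *)
Definition tpow (A : 'M[R]_n) (r : nat) : 'M[R]_(tdim n r) :=
  tmx (fun i j => \prod_(a < r) A (i a) (j a)).

Definition maximally_symmetric (d : nat) (A : 'M[R]_(tdim n d)) : Prop :=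
  forall (i : mindex n (d + d)) (sigma : 'S_(d + d)),
    tmx_entry A (mi_left (mi_perm i sigma)) (mi_right (mi_perm i sigma)) =
    tmx_entry A (mi_left i) (mi_right i).

Definition represents (d : nat) (f : {mpoly R[n]}) (A : 'M[R]_(tdim n d)) :
    Prop :=
  forall x : 'cV[R]_n,
    f.@[fun i => x i 0] = \tr (A^T *m tpow (x *m x^T) d).

(* The unique such matrix; it exists when f is homogeneous of degree 2d. *)
Definition MaxSym (d : nat) (f : {mpoly R[n]}) : 'M[R]_(tdim n d) :=
  xget 0 [set A | maximally_symmetric A /\ represents f A].

(* S^r(R^n). *)
Definition sym_tensor (r : nat) : set 'cV[R]_(tdim n r) :=
  [set v | forall (i : mindex n r) (sigma : 'S_r),
     tentry v (mi_perm i sigma) = tentry v i].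

(* The matrix P of the orthogonal projection onto a linear subspace S:
   for all v, P v lies in S and v - P v is orthogonal to S. *)
Definition orth_proj (N : nat) (S : set 'cV[R]_N) : 'M[R]_N :=
  xget 0 [set P | forall v : 'cV[R]_N,
    S (P *m v) /\ forall w, S w -> (v - P *m v)^T *m w = 0].

Definition symproj (r : nat) : 'M[R]_(tdim n r) := orth_proj (@sym_tensor r).

(* Π_r (A ⊗ I_n^{⊗(r-d)}) Π_r for r = d + k. *)
Definition sym_lift (d k : nat) (A : 'M[R]_(tdim n d)) :
    'M[R]_(tdim n (d + k)) :=
  symproj (d + k) *m tprod A (tpow 1%:M k) *m symproj (d + k).

Definition psdmx (N : nat) (A : 'M[R]_N) : Prop :=
  A^T = A /\ forall v : 'cV[R]_N, 0 <= (v^T *m A *m v) 0 0.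

Definition sumsq : {mpoly R[n]} := \sum_(i < n) 'X_i ^+ 2.

(* The ν with Q_r(p) - ν M_r ⪰ 0; meaningful for d <= r, where
   d + (r - d) = r. *)
Definition sp_set (d r : nat) (p : {mpoly R[n]}) : set R :=
  [set nu | psdmx (sym_lift (r - d) (MaxSym d p) -
                   nu *: sym_lift (r - d) (MaxSym d (sumsq ^+ d)))].

Definition sp (d r : nat) (p : {mpoly R[n]}) : R := sup (sp_set d r p).

Definition sphere_values (p : {mpoly R[n]}) : set R :=
  [set y | exists2 x : 'cV[R]_n,
     \sum_(i < n) x i 0 ^+ 2 = 1 & y = p.@[fun i => x i 0]].

Definition pmin (p : {mpoly R[n]}) : R := inf (sphere_values p).

End Tensors.

Definition is_max (R : realType) (A : set R) (m : R) : Prop :=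
  A m /\ ubound A m.
Definition is_min (R : realType) (A : set R) (m : R) : Prop :=
  A m /\ lbound A m.

(* The variables x1, x2, x3, x4, u are 'X_0, ..., 'X_4; u does not occur. *)
Definition choi_lam (R : realType) : {mpoly R[5]} :=
  let x1 := 'X_(inord 0) in
  let x2 := 'X_(inord 1) in
  let x3 := 'X_(inord 2) in
  let x4 := 'X_(inord 3) in
  x1 ^+ 2 * x2 ^+ 2 + x1 ^+ 2 * x3 ^+ 2 + x2 ^+ 2 * x3 ^+ 2 + x4 ^+ 4
  - 4%:R * (x1 * x2 * x3 * x4).

(* Main.v *)
Require Import Defs.
From mathcomp Require Import classical_sets reals.
From mathcomp Require Import all_boot all_order all_algebra all_fingroup.
From mathcomp Require Import mpoly ring lra.

(** The Choi-Lam form is nonnegative by the inequality between the arithmetic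
    and geometric means and vanishes on the [u]-axis, so its minimum on the
    sphere is [0]. Testing the inequality that defines the spectral bounds on
    powers [x^{⊗r}] of unit vectors shows that no bound exceeds the minimum
    ([sp_set_le_sphere]), so the spectral bound is nonpositive.

    On symmetric tensors [Q_r - nu M_r] has the quadratic form of
    [Q ⊗ I - nu (M ⊗ I)], and the form of [A ⊗ I] at [w] is the Gram form of
    [A] summed over the slices of [w] obtained by fixing its last [r - 2]
    indices ([slice_form]). The Gram form of [M] at a symmetric matrix [y] is
    [((tr y)^2 + 2 |y|^2) / 3] ([pairings_form]), hence [M_r >= 2/3] on
    symmetric tensors, and the set of admissible [nu] is nonempty, closed and
    bounded above: the maximum is attained ([sp2_is_max]).

    For the quadratic gap, let [w] be the symmetrization of
    [u^(r-2) (x1^2 - x2^2)], scaled to have entries [0], [1] and [-1]. As the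
    form does not involve [u], the only slice that counts is the one with all
    fixed indices equal to [u], and it is the matrix of [x1^2 - x2^2]. The Gram
    form of [Q] is negative there: the diagonal entries at [x1^2] and [x2^2]
    vanish, because [x1^4] and [x2^4] do not occur in the form, and the mixed
    entry is a positive fraction of the coefficient of [x1^2 x2^2]
    ([choi_lam_entry_mixed]). So [w^T Q_r w] is a negative constant independent
    of [r] ([test_tensor_choi_lam]), whereas [w^T M_r w] is at most a constant
    times [|w|^2], which is at most [2 r^2] because the nonzero entries of [w]
    are located by a pair of positions ([test_tensor_normsq]). The quotient is
    at most [- c / r^2].

    Computing with [MaxSym] requires the existence and uniqueness of the
    maximally symmetric matrix of a form: existence by averaging a coefficient
    tensor over all permutations of its positions ([MaxSym_spec]), uniqueness
    by polarization ([tform_eq0]). *)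

Set Implicit Arguments.
Unset Strict Implicit.
Unset Printing Implicit Defensive.

Import Order.TTheory GRing.Theory Num.Theory.
Local Open Scope ring_scope.

(** * Multi-indices *)

Section Indices.
Variables n : nat.
Implicit Types d k m : nat.

Definition mi_cat d k (i : mindex n d) (j : mindex n k) : mindex n (d + k) :=
  [ffun a => match split a with inl b => i b | inr c => j c end].

Lemma mi_cat_lshift d k (i : mindex n d) (j : mindex n k) a :
  mi_cat i j (lshift k a) = i a.
Proof.
rewrite ffunE (_ : split (lshift k a) = inl a) //.
exact: (unsplitK (inl _ a)).
Qed.

Lemma mi_cat_rshift d k (i : mindex n d) (j : mindex n k) b :
  mi_cat i j (rshift d b) = j b.
Proof.
rewrite ffunE (_ : split (rshift d b) = inr b) //.
exact: (unsplitK (inr _ b)).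
Qed.

Lemma mi_left_cat d k (i : mindex n d) (j : mindex n k) :
  mi_left (mi_cat i j) = i.
Proof. by apply/ffunP => a; rewrite ffunE mi_cat_lshift. Qed.

Lemma mi_right_cat d k (i : mindex n d) (j : mindex n k) :
  mi_right (mi_cat i j) = j.
Proof. by apply/ffunP => a; rewrite ffunE mi_cat_rshift. Qed.

Lemma mi_cat_split d k (i : mindex n (d + k)) :
  mi_cat (mi_left i) (mi_right i) = i.
Proof.
apply/ffunP => a; rewrite -(splitK a); case: (split a) => b /=.
  by rewrite mi_cat_lshift ffunE.
by rewrite mi_cat_rshift ffunE.
Qed.

Lemma sum_mi_cat (V : nmodType) d k (F : mindex n (d + k) -> V) :
  \sum_i F i = \sum_(i : mindex n d) \sum_(j : mindex n k) F (mi_cat i j).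
Proof.
rewrite pair_big /= (reindex (fun p : mindex n d * mindex n k => mi_cat p.1 p.2)) //.
exists (fun i => (mi_left i, mi_right i)) => [[i j] _|i _] /=.
  by rewrite mi_left_cat mi_right_cat.
exact: mi_cat_split.
Qed.

Lemma mi_permM m (i : mindex n m) (s t : 'S_m) :
  mi_perm (mi_perm i s) t = mi_perm i (t * s)%g.
Proof. by apply/ffunP => a; rewrite !ffunE permM. Qed.

Lemma mi_perm1 m (i : mindex n m) : mi_perm i 1%g = i.
Proof. by apply/ffunP => a; rewrite !ffunE perm1. Qed.

Lemma mi_perm_bij m (s : 'S_m) : bijective (fun i : mindex n m => mi_perm i s).
Proof.
exists (fun i => mi_perm i s^-1%g) => i; rewrite mi_permM.
  by rewrite mulVg mi_perm1.
by rewrite mulgV mi_perm1.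
Qed.

End Indices.

(** * Polarization *)

Section Polarization.
Variables (R : numDomainType) (n m : nat).
Implicit Types (T : mindex n m -> R) (i j : mindex n m).

Definition tform T (x : 'I_n -> R) : R := \sum_j T j * \prod_(a < m) x (j a).

(** The alternating sum over the supersets of [A] is the expansion of a product
    over all [k] of [1 - (k \notin A)], where [S] collects the factors that
    contribute their [1]; a single [k] outside [A] makes the product vanish. *)
Lemma sum_sign_supersets (A : {set 'I_m}) :
  \sum_(S : {set 'I_m} | A \subset S) (-1) ^+ #|~: S| = (A == setT)%:R :> R.
Proof.
transitivity (\prod_(k : 'I_m) (1 - (k \notin A)%:R) : R).
  rewrite bigA_distr [RHS](bigID (fun S : {set 'I_m} => A \subset S)) /=.
  rewrite [X in _ + X]big1 ?addr0 => [|S].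
    apply: eq_bigr => S sAS.
    rewrite (bigID (mem S)) /= big1 ?mul1r => [|k -> //].
    rewrite (eq_bigr (fun _ => -1)) => [|k /negPf kS]; last first.
      by rewrite kS; case: (boolP (k \in A)) => // /(subsetP sAS); rewrite kS.
    by rewrite prodr_const; congr (_ ^+ _); apply: eq_card => k; rewrite inE.
  case/subsetPn => k kA kS; rewrite (bigD1 k) //= (negPf kS) kA /= oppr0.
  by rewrite mul0r.
case: eqP => [->|/eqP].
  by rewrite big1 // => k _; rewrite inE subr0.
rewrite -subTset => /subsetPn[k _ kA].
by rewrite (bigD1 k) //= kA subrr mul0r.
Qed.

Lemma tform_partial_sum T i (S : {set 'I_m}) :
  tform T (fun b => \sum_(k in S) (i k == b)%:R) =
  \sum_(f : {ffun 'I_m -> 'I_m} | [set f a | a : 'I_m] \subset S)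
    T [ffun a => i (f a)].
Proof.
rewrite /tform; under eq_bigr do rewrite bigA_distr_big mulr_sumr.
rewrite exchange_big /=; apply: eq_big => f.
  apply/ffun_onP/subsetP => [fS _ /imsetP[a _ ->]|fS a]; first exact: fS.
  exact/fS/imset_f.
move=> _; rewrite (bigD1 [ffun a => i (f a)]) //= big1 ?mulr1 => [|a _].
  rewrite big1 ?addr0 // => j /eqP/ffunP ne_j.
  have [a ne_a] : exists a, i (f a) != j a.
    apply/existsP; rewrite -negb_forall; apply/forallP => eq_j; apply: ne_j => a.
    by rewrite ffunE; apply/esym/eqP.
  by rewrite (bigD1 a) //= (negPf ne_a) mul0r mulr0.
by rewrite ffunE eqxx.
Qed.

(** Inclusion-exclusion: in the sum over the subsets [S] of positions of the
    signed values of the form at [\sum_(k in S) e_(i k)], only the terms indexed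
    by surjections of the positions, that is permutations, survive; by symmetry
    these are all equal. *)
Lemma polarization T i :
  (forall j (s : 'S_m), T (mi_perm j s) = T j) ->
  \sum_(S : {set 'I_m})
    (-1) ^+ #|~: S| * tform T (fun b => \sum_(k in S) (i k == b)%:R) =
  T i *+ m`!.
Proof.
move=> Tsym; under eq_bigr do rewrite tform_partial_sum big_mkcond mulr_sumr.
rewrite exchange_big /= -card_Sn -sumr_const.
transitivity (\sum_(f : {ffun 'I_m -> 'I_m} | injectiveb f) T [ffun a => i (f a)]).
  rewrite [RHS]big_mkcond /=; apply: eq_bigr => f _.
  transitivity (([set f a | a : 'I_m] == setT)%:R * T [ffun a => i (f a)]).
    rewrite -sum_sign_supersets mulr_suml [RHS]big_mkcond /=.
    by apply: eq_bigr => S _; case: ifP; rewrite ?mulr0.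
  have -> : ([set f a | a : 'I_m] == setT) = injectiveb f.
    rewrite eqEcard finset.subsetT cardsT /=.
    apply/idP/injectiveP => [le_m a b|inj_f]; last by rewrite card_imset.
    have /imset_injP inj_f : #|[set f a | a : 'I_m]| == #|'I_m|.
      by rewrite eqn_leq leq_imset_card.
    exact: inj_f.
  by case: ifP; rewrite ?mul1r ?mul0r.
rewrite (reindex_onto (fun s : 'S_m => pval s)
  (fun f => insubd (1%g : 'S_m) f)) => [|f inj_f] /=; last exact: insubdK.
apply: eq_big => [s|s _]; first by rewrite valKd eqxx (valP s).
rewrite -(Tsym i s); congr (T _); apply/ffunP => a.
by rewrite !ffunE pvalE.
Qed.

Lemma tform_eq0 T :
  (forall j (s : 'S_m), T (mi_perm j s) = T j) ->
  (forall x, tform T x = 0) -> forall i, T i = 0.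
Proof.
move=> Tsym T0 i; have := polarization i Tsym.
rewrite big1 => [|S _]; last by rewrite T0 mulr0.
by move/esym/eqP; rewrite mulrn_eq0 eqn0Ngt fact_gt0 => /eqP.
Qed.

End Polarization.
(** * Maximally symmetric matrices *)

Section MaximallySymmetric.
Variables (R : realType) (n d : nat).
Implicit Types (f : {mpoly R[n]}) (A : 'M[R]_(tdim n d)).

(** A matrix indexed by pairs of multi-indices of length [d], read as a tensor
    of order [2 d]. *)
Definition mx_tensor A (i : mindex n (d + d)) : R :=
  tmx_entry A (mi_left i) (mi_right i).

Lemma tmx_entryK (F : mindex n d -> mindex n d -> R) i j :
  tmx_entry (tmx F) i j = F i j.
Proof. by rewrite /tmx_entry mxE !enum_rankK. Qed.

Lemma eq_tmx A B : (forall i j, tmx_entry A i j = tmx_entry B i j) -> A = B.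
Proof.
move=> eqAB; apply/matrixP => a b.
by have := eqAB (enum_val a) (enum_val b); rewrite /tmx_entry !enum_valK.
Qed.

Lemma sum_tdim (V : nmodType) (F : 'I_(tdim n d) -> V) :
  \sum_a F a = \sum_(i : mindex n d) F (enum_rank i).
Proof. by rewrite (reindex (@enum_rank (mindex n d))) //; apply/onW_bij/enum_rank_bij. Qed.

Lemma representsE f A : represents f A <->
  forall x : 'cV[R]_n, f.@[fun i => x i 0] = tform (mx_tensor A) (fun i => x i 0).
Proof.
have trE (x : 'cV[R]_n) : \tr (A^T *m tpow (x *m x^T) d) = tform (mx_tensor A) (fun i => x i 0).
  rewrite /mxtrace; under eq_bigr do rewrite mxE.
  rewrite exchange_big /= sum_tdim /tform sum_mi_cat; apply: eq_bigr => i _.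
  rewrite sum_tdim; apply: eq_bigr => j _.
  rewrite mxE /mx_tensor mi_left_cat mi_right_cat big_split_ord /=; congr (_ * _).
  rewrite mxE !enum_rankK -big_split /=; apply: eq_bigr => a _.
  by rewrite mxE big_ord1 mi_cat_lshift mi_cat_rshift mxE.
by split=> [fA x|fA x]; rewrite fA trE.
Qed.

(** A maximally symmetric matrix is determined by the form it represents,
    because its entries are recovered from the values of the form by
    polarization. *)
Lemma MaxSym_unique f A :
  maximally_symmetric A -> represents f A -> MaxSym d f = A.
Proof.
move=> Asym fA; apply: xget_unique => [|B [Bsym /representsE fB]]; first by split.
move/representsE in fA.
apply: eq_tmx => i j; apply/eqP; rewrite -subr_eq0; apply/eqP.
have := @tform_eq0 R n (d + d) (fun k => mx_tensor B k - mx_tensor A k) _ _ (mi_cat i j).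
rewrite /mx_tensor mi_left_cat mi_right_cat; apply=> [k s|x].
  by rewrite Asym Bsym.
rewrite /tform; under eq_bigr do rewrite mulrBl.
rewrite sumrB; pose y : 'cV[R]_n := \col_i x i.
have yE (k : mindex n (d + d)) : \prod_a x (k a) = \prod_a y (k a) 0.
  by apply: eq_bigr => a _; rewrite mxE.
under eq_bigr do rewrite yE.
under [X in _ - X]eq_bigr do rewrite yE.
by have := fB y; rewrite fA /tform => ->; rewrite subrr.
Qed.

(** Any coefficient tensor [F] of the form, symmetric or not, gives the
    maximally symmetric matrix by averaging over all permutations of positions:
    the monomial attached to a multi-index ignores the order of its entries. *)
Lemma MaxSym_spec f (F : mindex n (d + d) -> R) :
  (forall x, f.@[x] = tform F x) ->
  [/\ maximally_symmetric (MaxSym d f), represents f (MaxSym d f) &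
    forall i j, tmx_entry (MaxSym d f) i j =
      ((d + d)`!%:R)^-1 * \sum_(s : 'S_(d + d)) F (mi_perm (mi_cat i j) s)].
Proof.
move=> fF; pose T i := ((d + d)`!%:R)^-1 * \sum_(s : 'S_(d + d)) F (mi_perm i s).
pose A := tmx (fun i j => T (mi_cat i j)).
have AT i : mx_tensor A i = T i by rewrite /mx_tensor tmx_entryK mi_cat_split.
have Asym : maximally_symmetric A.
  move=> i s; rewrite -!/(mx_tensor _ _) !AT /T; congr (_ * _).
  rewrite [RHS](reindex_inj (mulIg s)) /=.
  by apply: eq_bigr => t _; rewrite mi_permM.
have fA : represents f A.
  apply/representsE => x; rewrite fF /tform.
  under [RHS]eq_bigr do rewrite AT /T -mulrA mulr_suml.
  rewrite -mulr_sumr exchange_big /=.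
  rewrite -/(tform F (fun i => x i 0)); set y := tform F _.
  rewrite (eq_bigr (fun _ => y)) => [|s _].
    rewrite sumr_const card_Sn -[y *+ _]mulr_natl mulKf //.
    by rewrite pnatr_eq0 -lt0n fact_gt0.
  rewrite /y /tform [RHS](reindex (fun i => mi_perm i s)); last exact/onW_bij/mi_perm_bij.
  apply: eq_bigr => i _; congr (_ * _); rewrite (reindex_inj (@perm_inj _ s)) /=.
  by apply: eq_bigr => a _; rewrite ffunE.
have AE := MaxSym_unique Asym fA; rewrite AE; split=> // i j.
by rewrite tmx_entryK.
Qed.

Lemma MaxSym_maxsym f : maximally_symmetric (MaxSym d f).
Proof.
rewrite /MaxSym; case: xgetP => [A _ [] //|_] i s.
by rewrite /tmx_entry !mxE.
Qed.

Lemma swap_halves_inj :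
  injective (fun a : 'I_(d + d) => unsplit (match split a with
    inl b => inr b | inr b => inl b end)).
Proof.
move=> a b /(congr1 split); rewrite !unsplitK => eq_ab; apply/(can_inj (@splitK d d)).
by move: eq_ab; case: (split a) => a'; case: (split b) => b' // [->].
Qed.

(** Transposition exchanges the two halves of a multi-index of length [2 d],
    which is one of the permutations that maximal symmetry allows. *)
Lemma maxsym_tr A : maximally_symmetric A -> A^T = A.
Proof.
move=> Asym; apply: eq_tmx => i j.
rewrite /tmx_entry mxE -!/(tmx_entry _ _ _).
have := Asym (mi_cat i j) (perm swap_halves_inj).
rewrite mi_left_cat mi_right_cat => <-; congr tmx_entry; apply/ffunP => a.
  by rewrite !ffunE permE (unsplitK (inl _ a)) /= (unsplitK (inr _ a)).
by rewrite !ffunE permE (unsplitK (inr _ a)) /= (unsplitK (inl _ a)).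
Qed.

End MaximallySymmetric.

(** * Symmetric tensors and the orthogonal projection onto them *)

Section OrthogonalProjection.
Variables (R : realType) (N : nat) (S : set 'cV[R]_N).
Hypothesis SB : forall v w, S v -> S w -> S (v - w).
Hypothesis projS : exists P : 'M[R]_N, forall v : 'cV[R]_N,
    S (P *m v) /\ forall w, S w -> (v - P *m v)^T *m w = 0.

Let P := orth_proj S.

Lemma orth_projP (v : 'cV[R]_N) :
  S (P *m v) /\ forall w, S w -> (v - P *m v)^T *m w = 0.
Proof. exact: (xgetPex 0 projS). Qed.

Lemma orth_proj_mem v : S (P *m v). Proof. by case: (orth_projP v). Qed.

Lemma normsq_eq0 (v : 'cV[R]_N) : v^T *m v = 0 -> v = 0.
Proof.
move=> v0; apply/matrixP => a b; rewrite ord1 !mxE; apply/eqP.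
have := congr1 (fun M : 'M_1 => M 0 0) v0; rewrite !mxE => /eqP.
rewrite psumr_eq0 => [/allP/(_ a)|c _]; last by rewrite mxE -expr2 sqr_ge0.
by rewrite mem_index_enum mxE -expr2 sqrf_eq0 => /(_ isT).
Qed.

Lemma orth_proj_id v : S v -> P *m v = v.
Proof.
move=> Sv; apply/esym/eqP; rewrite -subr_eq0; apply/eqP/normsq_eq0.
exact/(orth_projP v).2/SB/orth_proj_mem.
Qed.

(** The image of [P] is orthogonal to that of [1 - P], so [P = P^T P], and the
    right-hand side is its own transpose. *)
Lemma orth_proj_tr : P^T = P.
Proof.
have PPt : P = P^T *m P.
  suff eq_form (v w : 'cV[R]_N) : v^T *m (P *m w) = v^T *m (P^T *m P *m w).
    apply/matrixP => a b; have := eq_form (delta_mx a 0) (delta_mx b 0).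
    rewrite trmx_delta -!colE -!rowE => /matrixP/(_ 0 0).
    by rewrite [LHS]mxE [RHS]mxE [LHS]mxE [RHS]mxE.
  have [_ /(_ _ (orth_proj_mem w))/eqP] := orth_projP v.
  by rewrite linearB /= mulmxBl subr_eq0 trmx_mul !mulmxA => /eqP.
by rewrite {1}PPt trmx_mul trmxK -PPt.
Qed.

End OrthogonalProjection.

Section SymmetricTensors.
Variables (R : realType) (n r : nat).
Implicit Types v w : 'cV[R]_(tdim n r).

Lemma tentryB v w i : tentry (v - w) i = tentry v i - tentry w i.
Proof. by rewrite /tentry !mxE. Qed.

Lemma sym_tensorB v w :
  sym_tensor v -> sym_tensor w -> sym_tensor (v - w).
Proof. by move=> Sv Sw i s; rewrite !tentryB Sv Sw. Qed.

Lemma tentry_mul (A : 'M[R]_(tdim n r)) v i :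
  tentry (A *m v) i = \sum_j tmx_entry A i j * tentry v j.
Proof. by rewrite /tentry mxE sum_tdim. Qed.

(** Averaging over the permutations of the positions is an orthogonal
    projection: a symmetric tensor has the same inner product with a tensor
    and with each of its permuted copies. *)
Lemma sym_projection_exists : exists P : 'M[R]_(tdim n r),
  forall v, sym_tensor (P *m v) /\
    forall w, sym_tensor w -> (v - P *m v)^T *m w = 0.
Proof.
pose c : R := (r`!%:R)^-1.
exists (tmx (fun i j => c * \sum_(s : 'S_r) (mi_perm i s == j)%:R)) => v.
set Pv := _ *m v.
have PvE i : tentry Pv i = c * \sum_(s : 'S_r) tentry v (mi_perm i s).
  rewrite tentry_mul; under eq_bigr do rewrite tmx_entryK -mulrA mulr_suml.
  rewrite -mulr_sumr exchange_big /=; congr (_ * _); apply: eq_bigr => s _.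
  rewrite (bigD1 (mi_perm i s)) //= eqxx mul1r big1 ?addr0 // => j.
  by rewrite eq_sym => /negPf ->; rewrite mul0r.
split=> [i s|w Sw].
  rewrite !PvE [in RHS](reindex_inj (mulIg s)) /=; congr (_ * _).
  by apply: eq_bigr => t _; rewrite mi_permM.
rewrite linearB /= mulmxBl; apply/eqP; rewrite subr_eq0; apply/eqP/matrixP => a b.
rewrite !ord1 !mxE !sum_tdim.
under [RHS]eq_bigr do rewrite mxE -!/(tentry _ _) PvE -mulrA mulr_suml.
rewrite -mulr_sumr exchange_big /=.
set y := \sum_i tentry v i * tentry w i.
rewrite [X in c * X](eq_bigr (fun=> y)).
  rewrite sumr_const card_Sn -[y *+ _]mulr_natl mulKf.
    by apply: eq_bigr => i _; rewrite mxE.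
  by rewrite pnatr_eq0 -lt0n fact_gt0.
move=> s _; rewrite /y [RHS](reindex (fun i => mi_perm i s)).
  by apply: eq_bigr => i _; rewrite Sw.
exact/onW_bij/mi_perm_bij.
Qed.

Lemma symproj_sym v : sym_tensor (symproj R n r *m v).
Proof. exact: orth_proj_mem sym_projection_exists v. Qed.

Lemma symproj_id v : sym_tensor v -> symproj R n r *m v = v.
Proof. exact: orth_proj_id sym_tensorB sym_projection_exists v. Qed.

Lemma symproj_tr : (symproj R n r)^T = symproj R n r.
Proof. exact: orth_proj_tr sym_projection_exists. Qed.

End SymmetricTensors.

(** * The quadratic form of a lifted matrix *)

Section SliceForm.
Variables (R : realType) (n d k : nat).
Implicit Types (A : 'M[R]_(tdim n d)) (w v : 'cV[R]_(tdim n (d + k))).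

(** The quadratic form of [A ⊗ I]: the Gram form of [A], summed over the slices
    of [w] with fixed last [k] indices. *)
Definition slice_form A w : R :=
  \sum_(J : mindex n k) \sum_i \sum_j
    tmx_entry A i j * (tentry w (mi_cat i J) * tentry w (mi_cat j J)).

Definition normsq w : R :=
  \sum_(J : mindex n k) \sum_(i : mindex n d) tentry w (mi_cat i J) ^+ 2.

Lemma tpow1E (i j : mindex n k) : tmx_entry (tpow (1%:M : 'M[R]_n) k) i j = (i == j)%:R.
Proof.
rewrite tmx_entryK; case: eqP => [->|/eqP ne_ij].
  by rewrite big1 // => a _; rewrite mxE eqxx.
have [a ne_a] : exists a, i a != j a.
  apply/existsP; rewrite -negb_forall; apply: contra ne_ij => /forallP eq_ij.
  by apply/eqP/ffunP => a; apply/eqP.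
by rewrite (bigD1 a) //= mxE (negPf ne_a) mul0r.
Qed.

Lemma tprod1_form A w :
  (w^T *m tprod A (tpow 1%:M k) *m w) 0 0 = slice_form A w.
Proof.
rewrite -mulmxA mxE sum_tdim sum_mi_cat /slice_form exchange_big /=.
apply: eq_bigr => J _; apply: eq_bigr => i _.
rewrite mxE -!/(tentry _ _) tentry_mul sum_mi_cat mulr_sumr.
apply: eq_bigr => j _; rewrite (bigD1 J) //= big1 ?addr0 => [|J' ne_J].
  by rewrite tmx_entryK !mi_left_cat !mi_right_cat tpow1E eqxx mulr1 mulrCA.
by rewrite tmx_entryK !mi_right_cat tpow1E eq_sym (negPf ne_J) mulr0 mul0r.
Qed.

Lemma sym_lift_form A v :
  (v^T *m sym_lift k A *m v) 0 0 = slice_form A (symproj R n (d + k) *m v).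
Proof.
by rewrite -tprod1_form trmx_mul symproj_tr /sym_lift !mulmxA.
Qed.

Lemma sym_lift_tr A : A^T = A -> (sym_lift k A)^T = sym_lift k A.
Proof.
move=> Asym; rewrite /sym_lift !trmx_mul symproj_tr mulmxA; congr (_ *m _ *m _).
apply: eq_tmx => i j; rewrite /tmx_entry mxE -!/(tmx_entry _ _ _).
rewrite [LHS]tmx_entryK [RHS]tmx_entryK !tpow1E eq_sym; congr (_ * _).
by rewrite -{1}Asym /tmx_entry mxE.
Qed.

Lemma normsq_ge0 w : 0 <= normsq w.
Proof. by apply: sumr_ge0 => J _; apply: sumr_ge0 => i _; apply: sqr_ge0. Qed.

Lemma slice_form_bound A w :
  `|slice_form A w| <= (\sum_i \sum_j `|tmx_entry A i j|) * normsq w.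
Proof.
apply: le_trans (ler_norm_sum _ _ _) _; rewrite mulr_sumr.
apply: ler_sum => J _; apply: le_trans (ler_norm_sum _ _ _) _; rewrite mulr_suml.
apply: ler_sum => i _; apply: le_trans (ler_norm_sum _ _ _) _; rewrite mulr_suml.
apply: ler_sum => j _; rewrite normrM ler_wpM2l //.
set N := \sum_i _.
have le_N l : tentry w (mi_cat l J) ^+ 2 <= N.
  by rewrite /N (bigD1 l) //= lerDl sumr_ge0 // => l' _; apply: sqr_ge0.
have := le_N i; have := le_N j.
move: (tentry _ _) (tentry _ _) => a b leb lea.
have : 0 <= (a - b) ^+ 2 by apply: sqr_ge0.
have : 0 <= (a + b) ^+ 2 by apply: sqr_ge0.
by rewrite ler_norml => ? ?; apply/andP; split; nra.
Qed.

(** On a pure power the contracted positions each contribute the squared length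
    of the vector. *)
Lemma slice_form_power f A (x : 'cV[R]_n) : represents f A ->
  slice_form A (\col_a \prod_(b < d + k) x ((enum_val a : mindex n _) b) 0) =
  (\sum_i x i 0 ^+ 2) ^+ k * f.@[fun i => x i 0].
Proof.
move=> /representsE ->; rewrite -[k in RHS]card_ord -prodr_const bigA_distr_bigA.
rewrite mulr_suml; apply: eq_bigr => J _.
rewrite prodrXl expr2 /tform sum_mi_cat mulr_sumr; apply: eq_bigr => i _.
rewrite mulr_sumr; apply: eq_bigr => j _.
rewrite /tentry !mxE !enum_rankK /mx_tensor mi_left_cat mi_right_cat.
rewrite !big_split_ord /=.
under eq_bigr do rewrite mi_cat_lshift.
under [\prod_(_ < k) x (mi_cat i J _) 0]eq_bigr do rewrite mi_cat_rshift.
under [\prod_(_ < d) x (mi_cat j J _) 0]eq_bigr do rewrite mi_cat_lshift.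
under [\prod_(_ < k) x (mi_cat j J _) 0]eq_bigr do rewrite mi_cat_rshift.
under [\prod_(_ < d) x (mi_cat i j (lshift _ _)) 0]eq_bigr do rewrite mi_cat_lshift.
under [\prod_(_ < d) x (mi_cat i j (rshift _ _)) 0]eq_bigr do rewrite mi_cat_rshift.
by ring.
Qed.

End SliceForm.

Section SpectralSet.
Variables (R : realType) (n d r : nat).
Implicit Types f : {mpoly R[n]}.

Local Notation M := (MaxSym d (sumsq R n ^+ d)).

(** The projection in the definition of the lifted matrices disappears when the
    inequality is tested only on symmetric tensors. *)
Lemma sp_setP f nu : sp_set d r f nu <->
  forall w : 'cV[R]_(tdim n (d + (r - d))), sym_tensor w ->
    nu * slice_form M w <= slice_form (MaxSym d f) w.
Proof.
have formE v : (v^T *m (sym_lift (r - d) (MaxSym d f) - nu *: sym_lift (r - d) M) *m v) 0 0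
    = slice_form (MaxSym d f) (symproj R n _ *m v) -
      nu * slice_form M (symproj R n _ *m v).
  rewrite mulmxBr mulmxBl -scalemxAr -scalemxAl [LHS]mxE sym_lift_form.
  by rewrite [X in _ + X]mxE [X in - X]mxE sym_lift_form.
split=> [[_ psd] w Sw|le_w].
  by have := psd w; rewrite formE symproj_id // subr_ge0.
split=> [|v].
  by rewrite linearB linearZ /= !sym_lift_tr //; apply/maxsym_tr/MaxSym_maxsym.
by rewrite formE subr_ge0; apply/le_w/symproj_sym.
Qed.

(** Testing the defining inequality on the power tensor of a unit vector shows
    that every spectral bound is a lower bound for the form on the sphere. *)
Lemma sp_set_le_sphere f nu (x : 'cV[R]_n) :
  represents f (MaxSym d f) -> represents (sumsq R n ^+ d) M ->
  \sum_i x i 0 ^+ 2 = 1 -> sp_set d r f nu -> nu <= f.@[fun i => x i 0].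
Proof.
move=> repf reps x1 /sp_setP.
move=> /(_ (\col_a \prod_(b < d + (r - d)) x ((enum_val a : mindex n _) b) 0)).
rewrite (slice_form_power _ _ repf) (slice_form_power _ _ reps) x1 !expr1n !mul1r.
have -> : (sumsq R n ^+ d).@[fun i => x i 0] = 1.
  rewrite rmorphXn /= /sumsq rmorph_sum /=.
  under eq_bigr do rewrite rmorphXn /= mevalXU.
  by rewrite x1 expr1n.
rewrite mulr1; apply=> i s; rewrite /tentry !mxE !enum_rankK.
rewrite [RHS](reindex_inj (@perm_inj _ s)).
by apply: eq_bigr => a _; rewrite ffunE.
Qed.

(** Each symmetric tensor imposes an inequality linear in [nu] with a nonnegative
    slope, hence an upper bound on [nu] or nothing, and the supremum of the
    admissible [nu] still satisfies all of these inequalities. *)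
Lemma sp_is_max f :
  (forall w : 'cV[R]_(tdim n (d + (r - d))), sym_tensor w -> 0 <= slice_form M w) ->
  (exists nu, sp_set d r f nu) -> (exists b, ubound (sp_set d r f) b) ->
  is_max (sp_set d r f) (sp d r f).
Proof.
move=> M_ge0 ne ub; have hs : has_sup (sp_set d r f) by split.
split; last exact: sup_upper_bound hs.
apply/sp_setP => w Sw; have := M_ge0 w Sw; rewrite le_eqVlt => /predU1P[M0|M_gt0].
  case: ne => nu /sp_setP/(_ w Sw).
  by rewrite -M0 !mulr0.
rewrite -ler_pdivlMr //; apply: sup_le_ub => // nu /sp_setP/(_ w Sw).
by rewrite ler_pdivlMr.
Qed.

End SpectralSet.

(** * The square of the sum of squares *)

Section SumSquared.
Variables (R : realType) (n : nat).

Let o0 : 'I_(2 + 2) := lshift 2 ord0.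
Let o1 : 'I_(2 + 2) := lshift 2 ord_max.
Let o2 : 'I_(2 + 2) := rshift 2 ord0.
Let o3 : 'I_(2 + 2) := rshift 2 ord_max.

(** The maximally symmetric tensor of [s^2]: the mean of the three ways of
    contracting four positions in pairs. *)
Definition pairings (i : mindex n (2 + 2)) : R :=
  3^-1 * ((i o0 == i o1)%:R * (i o2 == i o3)%:R +
          (i o0 == i o2)%:R * (i o1 == i o3)%:R +
          (i o0 == i o3)%:R * (i o1 == i o2)%:R).

Lemma pairings_sym i (s : 'S_(2 + 2)) : pairings (mi_perm i s) = pairings i.
Proof.
have ord4P (a : 'I_(2 + 2)) : [\/ a = o0, a = o1, a = o2 | a = o3].
  case: a => [[|[|[|[|a]]]] lt_a] //; [constructor 1|constructor 2|constructor 3|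
    constructor 4]; exact: val_inj.
pose e a b : R := (i a == i b)%:R.
have eC a b : e a b = e b a by rewrite /e eq_sym.
rewrite /pairings !ffunE -!/(e _ _); congr (_ * _). clearbody e.
have inj_s a b : a != b -> s a != s b by rewrite (inj_eq perm_inj).
have := inj_s o0 o1 isT; have := inj_s o0 o2 isT; have := inj_s o0 o3 isT.
have := inj_s o1 o2 isT; have := inj_s o1 o3 isT; have := inj_s o2 o3 isT.
(* A permutation of the positions permutes the three pairings; the images of the
   four positions are enumerated, discarding the coincidences. *)
have [-> | -> | -> | ->] := ord4P (s o0); have [-> | -> | -> | ->] := ord4P (s o1);
  rewrite ?eqxx //; have [-> | -> | -> | ->] := ord4P (s o2); rewrite ?eqxx //;
  have [-> | -> | -> | ->] := ord4P (s o3); rewrite ?eqxx // => _ _ _ _ _ _;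
  rewrite ?(eC o1 o0) ?(eC o2 o0) ?(eC o3 o0) ?(eC o2 o1) ?(eC o3 o1) ?(eC o3 o2);
  ring.
Qed.

Lemma pairings_cat (i j : mindex n 2) : pairings (mi_cat i j) =
  3^-1 * ((i ord0 == i ord_max)%:R * (j ord0 == j ord_max)%:R +
          (j == i)%:R + (j == mi_perm i (tperm ord0 ord_max))%:R).
Proof.
rewrite /pairings /o0 /o1 /o2 /o3 !mi_cat_lshift !mi_cat_rshift -!natrM !mulnb.
congr (_ * (_ + _%:R + _%:R)).
  rewrite eq_sym [X in _ && X]eq_sym; congr nat_of_bool.
  apply/andP/eqP => [[/eqP e0 /eqP e1]|-> //]; apply/ffunP => a.
  by case: a => [[|[|a]] lt_a] //; [rewrite (_ : Ordinal _ = ord0)|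
    rewrite (_ : Ordinal _ = ord_max)] => //; apply: val_inj.
congr nat_of_bool; apply/andP/eqP => [[/eqP e0 /eqP e1]|->]; last first.
  by rewrite !ffunE tpermL tpermR !eqxx.
apply/ffunP => a; rewrite ffunE.
case: a => [[|[|a]] lt_a] //.
  by rewrite (_ : Ordinal _ = ord0) ?tpermL //; apply: val_inj.
by rewrite (_ : Ordinal _ = ord_max) ?tpermR //; apply: val_inj.
Qed.

(** The three pairings of four positions contract a pair of tensors of order
    two into the product of the traces, the inner product, and the inner product
    with the second one transposed. *)
Lemma pairings_form (y : mindex n 2 -> R) :
  \sum_i \sum_j pairings (mi_cat i j) * (y i * y j) =
  3^-1 * ((\sum_(i : mindex n 2) (i ord0 == i ord_max)%:R * y i) ^+ 2 +
    \sum_i y i ^+ 2 + \sum_i y i * y (mi_perm i (tperm ord0 ord_max))).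
Proof.
rewrite expr2 mulr_suml -!big_split /= mulr_sumr; apply: eq_bigr => i _.
transitivity (3^-1 * \sum_(j : mindex n 2) ((i ord0 == i ord_max)%:R * y i *
   ((j ord0 == j ord_max)%:R * y j) + (j == i)%:R * (y i * y j) +
    (j == mi_perm i (tperm ord0 ord_max))%:R * (y i * y j))).
  by rewrite mulr_sumr; apply: eq_bigr => j _; rewrite pairings_cat; ring.
rewrite !big_split /= mulr_sumr; congr (_ * (_ + _ + _)).
  rewrite (bigD1 i) //= eqxx mul1r -expr2 big1 ?addr0 // => j /negPf ->.
  by rewrite mul0r.
rewrite (bigD1 (mi_perm i (tperm ord0 ord_max))) //= eqxx mul1r big1 ?addr0 //.
by move=> j /negPf ->; rewrite mul0r.
Qed.

Lemma sumsq2_tform x : (sumsq R n ^+ 2).@[x] = tform pairings x.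
Proof.
have sE : (sumsq R n).@[x] = \sum_i x i ^+ 2.
  by rewrite /sumsq rmorph_sum /=; apply: eq_bigr => i _; rewrite rmorphXn /= mevalXU.
rewrite rmorphXn /= sE /tform sum_mi_cat.
pose y (i : mindex n 2) := x (i ord0) * x (i ord_max).
have yE (i : mindex n 2) : y i = \prod_a x (i a).
  by rewrite big_ord_recl big_ord1; congr (_ * x (i _)); apply: val_inj.
transitivity (\sum_i \sum_j pairings (mi_cat i j) * (y i * y j)); last first.
  apply: eq_bigr => i _; apply: eq_bigr => j _; congr (_ * _).
  rewrite big_split_ord /= !yE; congr (_ * _); apply: eq_bigr => a _.
    by rewrite mi_cat_lshift.
  by rewrite mi_cat_rshift.
have y2E : \sum_i y i ^+ 2 = (\sum_i x i ^+ 2) ^+ 2.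
  transitivity (\prod_(a < 2) \sum_i x i ^+ 2); last by rewrite prodr_const card_ord.
  rewrite bigA_distr_bigA.
  by apply: eq_bigr => i _; rewrite yE prodrXl.
rewrite pairings_form.
rewrite [X in _ + X](eq_bigr (fun i => y i ^+ 2)) => [|i _]; last first.
  by rewrite /y !ffunE tpermL tpermR mulrC [X in X * _]mulrC -expr2.
rewrite y2E; set t := \sum_i _ * y i.
have -> : t = \sum_i x i ^+ 2.
  rewrite /t (bigID (fun i : mindex n 2 => i ord0 == i ord_max)) /=.
  rewrite [X in _ + X]big1 ?addr0 => [|i /negPf ->]; last by rewrite mul0r.
  rewrite (reindex_onto (fun a => [ffun _ => a] : mindex n 2) (fun i => i ord0)) /=.
    by apply: eq_big => a; rewrite /y ?ffunE !eqxx // mul1r.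
  move=> i /eqP e01; apply/ffunP => a; rewrite ffunE.
  case: a => [[|[|a]] lt_a] //; first by congr (i _); apply: val_inj.
  by rewrite e01; congr (i _); apply: val_inj.
by field.
Qed.

Let M := MaxSym 2 (sumsq R n ^+ 2).

Lemma sumsq2_represents : represents (sumsq R n ^+ 2) M.
Proof. by case: (MaxSym_spec sumsq2_tform). Qed.

Lemma sumsq2_entry i j : tmx_entry M i j = pairings (mi_cat i j).
Proof.
have [_ _ ->] := MaxSym_spec sumsq2_tform.
rewrite (eq_bigr (fun=> pairings (mi_cat i j))) => [|s _]; last exact: pairings_sym.
rewrite sumr_const card_Sn -[pairings _ *+ _]mulr_natl mulKf //.
by rewrite pnatr_eq0 -lt0n fact_gt0.
Qed.

(** Contracting a symmetric tensor with the three pairings yields a squared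
    trace and twice a squared norm, for every value of the remaining positions. *)
Lemma sumsq2_form_ge k (w : 'cV[R]_(tdim n (2 + k))) :
  sym_tensor w -> 2 / 3 * normsq w <= slice_form M w.
Proof.
move=> Sw; rewrite /normsq mulr_sumr; apply: ler_sum => J _.
under [leRHS]eq_bigr do under eq_bigr do rewrite sumsq2_entry.
rewrite (pairings_form (fun i => tentry w (mi_cat i J))).
rewrite [X in _ * (_ + X)](eq_bigr (fun i => tentry w (mi_cat i J) ^+ 2)).
  set t := \sum_i _ * tentry _ _; have := sqr_ge0 t.
  by move: (t ^+ 2) (\sum_i _) => a b; lra.
move=> i _; rewrite expr2; congr (_ * _).
rewrite -[RHS](Sw _ (tperm (lshift k ord0) (lshift k ord_max))); congr tentry.
apply/ffunP => a; rewrite [RHS]ffunE -(splitK a); case: (split a) => b /=.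
  rewrite mi_cat_lshift ffunE.
  case: b => [[|[|b]] lt_b] //.
    rewrite (_ : Ordinal _ = ord0); last exact: val_inj.
    by rewrite !tpermL mi_cat_lshift.
  rewrite (_ : Ordinal _ = ord_max); last exact: val_inj.
  by rewrite !tpermR mi_cat_lshift.
by rewrite tpermD ?mi_cat_rshift // eq_lrshift.
Qed.

End SumSquared.

(** Definiteness of the denominator on symmetric tensors makes the spectral
    bound of a representable quartic form a genuine maximum. *)
Theorem sp2_is_max (R : realType) (n r : nat) (f : {mpoly R[n.+1]}) :
  represents f (MaxSym 2 f) -> is_max (sp_set 2 r f) (sp 2 r f).
Proof.
move=> repf; apply: sp_is_max => [w Sw||].
- apply: le_trans (sumsq2_form_ge Sw).
  by rewrite mulr_ge0 ?normsq_ge0 // divr_ge0.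
- set C : R := \sum_i \sum_j `|tmx_entry (MaxSym 2 f) i j|.
  have C_ge0 : 0 <= C by apply: sumr_ge0 => i _; apply: sumr_ge0.
  (* The numerator is at least [- C |w|^2], the denominator at least
     [2/3 |w|^2]. *)
  exists (- (3 / 2 * C)); apply/sp_setP => w Sw.
  have := sumsq2_form_ge Sw; have := slice_form_bound (MaxSym 2 f) w.
  rewrite -/C ler_norml => /andP[lb _] M_ge; apply: le_trans lb.
  rewrite mulNr lerN2 (_ : C * _ = 3 / 2 * C * (2 / 3 * normsq w)); last by field.
  by rewrite ler_wpM2l // mulr_ge0 // divr_ge0.
- pose x : 'cV[R]_n.+1 := delta_mx 0 0; exists (f.@[fun i => x i 0]) => nu spnu.
  apply: (sp_set_le_sphere (x := x) repf (@sumsq2_represents R n.+1) _ spnu).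
  rewrite (bigD1 ord0) //= big1 ?addr0 => [|i /negPf ne_i].
    by rewrite mxE !eqxx expr1n.
  by rewrite mxE ne_i expr0n.
Qed.

(** * The Choi-Lam form *)

Lemma inord5_eq (a b : nat) : (a < 5)%N -> (b < 5)%N ->
  (inord a == inord b :> 'I_5) = (a == b).
Proof. by move=> a5 b5; rewrite -val_eqE /= !inordK. Qed.

Section ChoiLam.
Variable R : realType.

Definition word (a b c d : 'I_5) : mindex 5 (2 + 2) :=
  [ffun k : 'I_(2 + 2) => nth a [:: a; b; c; d] k].

Definition cst (z : 'I_5) m : mindex 5 m := [ffun=> z].

Lemma word_missing a b c d z (i : mindex 5 (2 + 2)) (k : 'I_(2 + 2)) :
  i k = z -> z \notin [:: a; b; c; d] -> (i == word a b c d) = false.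
Proof.
move=> <-; apply: contraNF => /eqP ->; rewrite ffunE.
by apply: mem_nth; apply: ltn_ord.
Qed.

Lemma word_extra a b c d z (i : mindex 5 (2 + 2)) :
  (forall k, i k != z) -> z \in [:: a; b; c; d] -> (i == word a b c d) = false.
Proof.
move=> iz zin; apply/negP => /eqP def_i.
have lt_z : (index z [:: a; b; c; d] < 2 + 2)%N by rewrite index_mem.
by have := iz (Ordinal lt_z); rewrite def_i ffunE /= nth_index ?eqxx.
Qed.

Definition choi_lam_coef (i : mindex 5 (2 + 2)) : R :=
  (i == word (inord 0) (inord 0) (inord 1) (inord 1))%:R
  + (i == word (inord 0) (inord 0) (inord 2) (inord 2))%:R
  + (i == word (inord 1) (inord 1) (inord 2) (inord 2))%:R
  + (i == word (inord 3) (inord 3) (inord 3) (inord 3))%:R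
  - 4 * (i == word (inord 0) (inord 1) (inord 2) (inord 3))%:R.

Lemma choi_lam_eval (x : 'I_5 -> R) : (choi_lam R).@[x] =
  let: (x1, x2, x3, x4) := (x (inord 0), x (inord 1), x (inord 2), x (inord 3)) in
  x1 ^+ 2 * x2 ^+ 2 + x1 ^+ 2 * x3 ^+ 2 + x2 ^+ 2 * x3 ^+ 2 + x4 ^+ 4
  - 4 * (x1 * x2 * x3 * x4).
Proof.
by rewrite /choi_lam !(mevalB, mevalD, mevalM, rmorphXn, mevalXU) /= meval1; ring.
Qed.

Lemma choi_lam_tform x : (choi_lam R).@[x] = tform choi_lam_coef x.
Proof.
have monE a b c d : \sum_(i : mindex 5 (2 + 2))
    (i == word a b c d)%:R * \prod_k x (i k) = x a * x b * x c * x d.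
  rewrite (bigD1 (word a b c d)) //= eqxx mul1r [X in _ + X]big1 ?addr0 => [|i /negPf ->].
    by rewrite !big_ord_recl big_ord0 !ffunE /= mulr1 !mulrA.
  by rewrite mul0r.
have linE (a b c d e y : R) : (a + b + c + d - 4 * e) * y =
    a * y + b * y + c * y + d * y - 4 * (e * y) by ring.
rewrite choi_lam_eval /tform; under [RHS]eq_bigr do rewrite /choi_lam_coef linE.
by rewrite sumrB !big_split /= -mulr_sumr !monE; ring.
Qed.

Let Q := MaxSym 2 (choi_lam R).

Lemma choi_lam_represents : represents (choi_lam R) Q.
Proof. by case: (MaxSym_spec choi_lam_tform). Qed.

Lemma choi_lam_entry i j : tmx_entry Q i j =
  ((2 + 2)`!%:R)^-1 * \sum_(s : 'S_(2 + 2)) choi_lam_coef (mi_perm (mi_cat i j) s).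
Proof. by case: (MaxSym_spec choi_lam_tform). Qed.

(** The form does not involve the last variable [u], while every permutation of
    a word containing [u] still contains it and so has coefficient zero. *)
Lemma choi_lam_entry_u (i j : mindex 5 2) a : i a = inord 4 -> tmx_entry Q i j = 0.
Proof.
move=> ia; rewrite choi_lam_entry big1 ?mulr0 // => s _.
have is4 : mi_perm (mi_cat i j) s (s^-1%g (lshift 2 a)) = inord 4.
  by rewrite ffunE permKV mi_cat_lshift.
rewrite /choi_lam_coef !(word_missing is4) ?inE ?inord5_eq //.
by rewrite !addr0 mulr0 subr0.
Qed.

(** The fourth powers of [x1], [x2] and [x3] do not occur in the form. *)
Lemma choi_lam_entry_pure (z : nat) : (z < 3)%N ->
  tmx_entry Q (cst (inord z) 2) (cst (inord z) 2) = 0.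
Proof.
move=> z3; rewrite choi_lam_entry big1 ?mulr0 // => s _.
set i := mi_perm _ s.
have iE l : i l = inord z.
  rewrite ffunE -(splitK (s l)); case: (split _) => a /=.
    by rewrite mi_cat_lshift ffunE.
  by rewrite mi_cat_rshift ffunE.
have wE y a b c d : (y < 5)%N -> z != y -> inord y \in [:: a; b; c; d] ->
    (i == word a b c d) = false.
  by move=> y5 zy; apply: word_extra => l; rewrite iE inord5_eq // (ltn_trans z3).
rewrite /choi_lam_coef (wE 3%N (inord 3)) ?inE ?eqxx ?orbT ?(gtn_eqF z3) ?ltn_eqF //.
clearbody i; case: z z3 iE wE => [|[|[|z]]] // _ _ wE.
- rewrite (wE 1%N) ?inE ?eqxx ?orbT // (wE 2) ?inE ?eqxx ?orbT //.
  rewrite !(wE 1%N) ?inE ?eqxx ?orbT //.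
  by rewrite !addr0 mulr0 subr0.
- rewrite (wE 0%N) ?inE ?eqxx ?orbT // (wE 2) ?inE ?eqxx ?orbT //.
  rewrite (wE 2%N) ?inE ?eqxx ?orbT // (wE 0%N) ?inE ?eqxx ?orbT //.
  by rewrite !addr0 mulr0 subr0.
- rewrite (wE 0%N) ?inE ?eqxx ?orbT // (wE 0%N) ?inE ?eqxx ?orbT //.
  rewrite !(wE 1%N) ?inE ?eqxx ?orbT //.
  by rewrite !addr0 mulr0 subr0.
Qed.

(** The entry is an average of coefficients of words in [x1] and [x2]; the only
    monomial of the form in these two variables is [x1^2 x2^2], with a positive
    coefficient, and the identity permutation already attains it. *)
Lemma choi_lam_entry_mixed :
  0 < tmx_entry Q (cst (inord 0) 2) (cst (inord 1) 2).
Proof.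
rewrite choi_lam_entry mulr_gt0 ?invr_gt0 ?ltr0n ?fact_gt0 //.
set i := mi_cat _ _.
have coef_ge s : (mi_perm i s == word (inord 0) (inord 0) (inord 1) (inord 1))%:R
    <= choi_lam_coef (mi_perm i s).
  have ne2 k : mi_perm i s k != inord 2.
    rewrite ffunE -(splitK (s k)); case: (split _) => a /=.
      by rewrite mi_cat_lshift ffunE inord5_eq.
    by rewrite mi_cat_rshift ffunE inord5_eq.
  rewrite /choi_lam_coef (@word_extra (inord 0) (inord 1) _ _ _ _ ne2) ?inE ?eqxx ?orbT //.
  by rewrite mulr0 subr0 -!addrA lerDl !addr_ge0.
rewrite (bigD1 1%g) //= ltr_wpDr //; last first.
  apply: lt_le_trans (coef_ge 1%g); rewrite mi_perm1 [_ == _](_ : _ = true) ?ltr01 //.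
  apply/eqP/ffunP => l; rewrite [RHS]ffunE -(splitK l).
  case: (split l) => a; rewrite /= ?mi_cat_lshift ?mi_cat_rshift ffunE.
    by case: a => [[|[|a]] lt_a].
  by case: a => [[|[|a]] lt_a].
by apply: sumr_ge0 => s _; apply: le_trans (coef_ge s).
Qed.

(** Two nested applications of [a^2 + b^2 >= 2 a b], first to the pairs of
    monomials with the common factor [x1^2] and without it, then to [x1] and
    [x4]; the sign of [x2 x3] decides which squares to complete. *)
Lemma choi_lam_ge0 (x : 'I_5 -> R) : 0 <= (choi_lam R).@[x].
Proof.
rewrite choi_lam_eval; move: (x _) (x _) (x _) (x _) => x4 x3 x2 x1 /=.
case: (lerP 0 (x2 * x3)) => [t_ge0|t_lt0].
  have -> : x1 ^+ 2 * x2 ^+ 2 + x1 ^+ 2 * x3 ^+ 2 + x2 ^+ 2 * x3 ^+ 2 + x4 ^+ 4 -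
      4 * (x1 * x2 * x3 * x4) = (x1 * (x2 - x3)) ^+ 2 +
      (x2 * x3 - x4 ^+ 2) ^+ 2 + 2 * (x2 * x3) * (x1 - x4) ^+ 2 by ring.
  by rewrite !addr_ge0 ?sqr_ge0 // mulr_ge0 ?sqr_ge0 // mulr_ge0.
have -> : x1 ^+ 2 * x2 ^+ 2 + x1 ^+ 2 * x3 ^+ 2 + x2 ^+ 2 * x3 ^+ 2 + x4 ^+ 4 -
    4 * (x1 * x2 * x3 * x4) = (x1 * (x2 + x3)) ^+ 2 +
    (x2 * x3 + x4 ^+ 2) ^+ 2 + 2 * - (x2 * x3) * (x1 + x4) ^+ 2 by ring.
by rewrite !addr_ge0 ?sqr_ge0 // mulr_ge0 ?sqr_ge0 // mulr_ge0 // oppr_ge0 ltW.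
Qed.

Definition u_axis : 'cV[R]_5 := delta_mx (inord 4) 0.

Lemma u_axis_unit : \sum_i u_axis i 0 ^+ 2 = 1.
Proof.
rewrite (bigD1 (inord 4)) //= big1 ?addr0 => [|i /negPf ne_i].
  by rewrite mxE !eqxx expr1n.
by rewrite mxE ne_i expr0n.
Qed.

Lemma choi_lam_u_axis : (choi_lam R).@[fun i => u_axis i 0] = 0.
Proof. by rewrite choi_lam_eval /= !mxE !inord5_eq //=; ring. Qed.

Lemma choi_lam_min : is_min (sphere_values (choi_lam R)) 0.
Proof.
split; first by exists u_axis; rewrite ?u_axis_unit ?choi_lam_u_axis.
by move=> _ [x _ ->]; apply: choi_lam_ge0.
Qed.

Lemma choi_lam_pmin : pmin (choi_lam R) = 0.
Proof.
have [mem0 lb0] := choi_lam_min; apply/le_anti/andP; split.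
  by apply: ge_inf mem0; exists 0.
by apply: lb_le_inf lb0; exists 0.
Qed.

(** * The test tensor *)

Section TestTensor.
Variable k : nat.

Definition occ m (z : 'I_5) (i : mindex 5 m) : nat := \sum_a (i a == z).

Lemma occ_perm m z (i : mindex 5 m) s : occ z (mi_perm i s) = occ z i.
Proof.
rewrite /occ [RHS](reindex_inj (@perm_inj _ s)).
by apply: eq_bigr => a _; rewrite ffunE.
Qed.

Lemma occ_cat d l z (i : mindex 5 d) (j : mindex 5 l) :
  occ z (mi_cat i j) = (occ z i + occ z j)%N.
Proof.
rewrite /occ big_split_ord /=; congr addn; apply: eq_bigr => a _.
  by rewrite mi_cat_lshift.
by rewrite mi_cat_rshift.
Qed.

Lemma occ_leqif m z (i : mindex 5 m) : (occ z i <= m ?= iff (i == cst z m))%N.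
Proof.
rewrite -[m in X in (_ <= X ?= iff _)%N]card_ord -sum1_card.
have -> : (i == cst z m) = [forall a, i a == z].
  apply/eqP/forallP => [-> a|iz]; first by rewrite ffunE.
  by apply/ffunP => a; rewrite ffunE; apply/eqP.
by apply: (leqif_sum (C := fun a => i a == z)) => a _; split; case: (i a == z).
Qed.

Definition pair_in_u (z : 'I_5) (i : mindex 5 (2 + k)) : bool :=
  (occ z i == 2) && (occ (inord 4) i == k).

(** The symmetrization of [u^k (x1^2 - x2^2)], up to a positive scalar. *)
Definition test_tensor : 'cV[R]_(tdim 5 (2 + k)) :=
  \col_a ((pair_in_u (inord 0) (enum_val a))%:R -
          (pair_in_u (inord 1) (enum_val a))%:R).

Lemma test_tensorE i : tentry test_tensor i =
  (pair_in_u (inord 0) i)%:R - (pair_in_u (inord 1) i)%:R.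
Proof. by rewrite /tentry mxE enum_rankK. Qed.

Lemma test_tensor_sym : sym_tensor test_tensor.
Proof. by move=> i s; rewrite !test_tensorE /pair_in_u !occ_perm. Qed.

Lemma pair_in_u_cat z (i : mindex 5 2) (J : mindex 5 k) :
  z != inord 4 -> (forall a, i a != inord 4) ->
  pair_in_u z (mi_cat i J) = (J == cst (inord 4) k) && (i == cst z 2).
Proof.
move=> z4 i4; rewrite /pair_in_u !occ_cat.
have -> : occ (inord 4) i = 0%N by rewrite /occ big1 // => a _; rewrite (negPf (i4 a)).
rewrite add0n (occ_leqif _ J) andbC; apply: andb_id2l => /eqP ->.
rewrite (_ : occ z (cst _ k) = 0%N) ?addn0 ?(occ_leqif _ i) // /occ big1 // => a _.
by rewrite ffunE eq_sym (negPf z4).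
Qed.

(** The form does not involve [u], so only slices with all remaining entries
    equal to [u] and no entry [u] among the first two contribute: the value is
    the value of the Gram form at [x1^2 - x2^2], whatever the degree. *)
Lemma test_tensor_choi_lam : slice_form Q test_tensor =
  - (2 * tmx_entry Q (cst (inord 0) 2) (cst (inord 1) 2)).
Proof.
pose y (i : mindex 5 2) : R := (i == cst (inord 0) 2)%:R - (i == cst (inord 1) 2)%:R.
have Qtr : Q^T = Q by apply/maxsym_tr/MaxSym_maxsym.
have QC i j : tmx_entry Q i j = tmx_entry Q j i.
  by rewrite -[in LHS]Qtr /tmx_entry mxE.
have yE (i : mindex 5 2) J : (forall a, i a != inord 4) ->
    tentry test_tensor (mi_cat i J) = (J == cst (inord 4) k)%:R * y i.
  move=> i4; rewrite test_tensorE !pair_in_u_cat ?inord5_eq //.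
  by rewrite /y; case: (J == _); rewrite ?mul1r ?mul0r ?subrr.
have sum_y (F : mindex 5 2 -> R) :
    \sum_i F i * y i = F (cst (inord 0) 2) - F (cst (inord 1) 2).
  have sum1 z : \sum_i F i * (i == cst z 2)%:R = F (cst z 2).
    rewrite (bigD1 (cst z 2)) //= eqxx mulr1 big1 ?addr0 // => i /negPf ->.
    by rewrite mulr0.
  by rewrite /y; under eq_bigr do rewrite mulrBr; rewrite sumrB !sum1.
transitivity (\sum_i \sum_j tmx_entry Q i j * y j * y i).
  rewrite /slice_form (bigD1 (cst (inord 4) k)) //= [X in _ + X]big1 ?addr0.
    apply: eq_bigr => i _; apply: eq_bigr => j _.
    case: (pickP (fun a => i a == inord 4)) => [a /eqP ia|i4].
      by rewrite (choi_lam_entry_u j ia) !mul0r.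
    case: (pickP (fun a => j a == inord 4)) => [a /eqP ja|j4].
      by rewrite QC (choi_lam_entry_u i ja) !mul0r.
    rewrite !yE => [|a|a]; rewrite ?i4 ?j4 //.
    by rewrite eqxx !mul1r -mulrA [y j * _]mulrC.
  move=> J /negPf neJ; apply: big1 => i _; apply: big1 => j _.
  case: (pickP (fun a => i a == inord 4)) => [a /eqP ia|i4].
    by rewrite (choi_lam_entry_u j ia) mul0r.
  by rewrite yE => [|a]; rewrite ?i4 // neJ !mul0r mulr0.
under eq_bigr do rewrite -mulr_suml sum_y.
rewrite sum_y !choi_lam_entry_pure // [tmx_entry _ (cst (inord 1) 2) _]QC.
by ring.
Qed.

(** Such a multi-index is determined by the positions of its two entries [z]. *)
Lemma card_pair_in_u z : z != inord 4 ->
  (#|[set i | pair_in_u z i]| <= (2 + k) ^ 2)%N.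
Proof.
move=> z4; pose f (p : 'I_(2 + k) * 'I_(2 + k)) : mindex 5 (2 + k) :=
  [ffun a => if (a == p.1) || (a == p.2) then z else inord 4].
have sub : [set i | pair_in_u z i] \subset [set f p | p : 'I_(2 + k) * 'I_(2 + k)].
  apply/subsetP => i; rewrite inE => /andP[/eqP iz /eqP iu].
  (* The two counts add up to the length, so no third value occurs. *)
  have cover : forall a, (i a == z) || (i a == inord 4).
    have [_ cov] : (\sum_a ((i a == z) + (i a == inord 4)) <= \sum_(a < 2 + k) 1
        ?= iff [forall a, (i a == z) || (i a == inord 4)])%N.
      apply: (leqif_sum (C := fun a => (i a == z) || (i a == inord 4))) => a _.
      case: (eqVneq (i a) z) => [->|_]; first by rewrite (negPf z4).
      by split; case: (i a == _).
    apply/forallP; rewrite -cov big_split /= -!/(occ _ _) iz iu.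
    by rewrite sum1_card card_ord.
  have /eqP/cards2P[a [b [_ def_ab]]] : #|[set a | i a == z]| = 2.
    by rewrite -iz /occ -sum1_card big_mkcond; apply: eq_bigr => a _; rewrite inE; case: eqP.
  apply/imsetP; exists (a, b) => //; apply/ffunP => c; rewrite ffunE /=.
  have := in_set2 c a b; rewrite -def_ab inE => <-.
  by have := cover c; case: (eqVneq (i c) z) => [->|_ /= /eqP].
apply: leq_trans (subset_leq_card sub) _; apply: leq_trans (leq_imset_card _ _) _.
by rewrite cardT -cardE card_prod card_ord.
Qed.

Lemma test_tensor_normsq : normsq test_tensor <= 2 * (2 + k)%:R ^+ 2.
Proof.
have sum_pair z : z != inord 4 ->
    \sum_i (pair_in_u z i)%:R <= (2 + k)%:R ^+ 2 :> R.
  move=> z4; rewrite -natr_sum -natrX ler_nat.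
  apply: leq_trans (card_pair_in_u z4).
  by rewrite -sum1_card [leqRHS]big_mkcond leq_sum // => i _; rewrite inE; case: ifP.
rewrite /normsq exchange_big /= -(sum_mi_cat (fun i => tentry test_tensor i ^+ 2)).
apply: (@le_trans _ _ (\sum_i ((pair_in_u (inord 0) i)%:R + (pair_in_u (inord 1) i)%:R))).
  apply: ler_sum => i _; rewrite test_tensorE.
  by do 2![case: (pair_in_u _ i)]; rewrite ?(subrr, subr0, sub0r, addr0, add0r,
    expr0n, expr1n, sqrrN) //=; lra.
by rewrite big_split /= mulr_natl mulr2n lerD // sum_pair // inord5_eq.
Qed.

End TestTensor.
End ChoiLam.

Theorem theorem5p8 (R : realType) :
  let p := choi_lam R in
  [/\ is_min (sphere_values p) (pmin p),
      (forall r : nat, (2 <= r)%N -> is_max (sp_set 2 r p) (sp 2 r p)),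
      pmin p = 0,
      (forall r : nat, (2 <= r)%N -> pmin p - sp 2 r p = `|sp 2 r p|) &
      exists2 c : R, 0 < c &
      exists2 r0 : nat, (2 <= r0)%N &
      forall r : nat, (r0 <= r)%N -> c / r%:R ^+ 2 <= pmin p - sp 2 r p].
Proof.
move=> p; have repp : represents p (MaxSym 2 p) := @choi_lam_represents R.
have sp_max r : is_max (sp_set 2 r p) (sp 2 r p) := sp2_is_max r repp.
have sp_le0 r : sp 2 r p <= 0.
  rewrite -(choi_lam_u_axis R).
  exact: sp_set_le_sphere repp (@sumsq2_represents R 5) (u_axis_unit R) (sp_max r).1.
rewrite choi_lam_pmin; split=> //; first exact: choi_lam_min.
  by move=> r _; rewrite sub0r ler0_norm.
set delta := tmx_entry (MaxSym 2 p) (cst (inord 0) 2) (cst (inord 1) 2).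
have delta_gt0 : 0 < delta := choi_lam_entry_mixed R.
set C : R := \sum_i \sum_j `|tmx_entry (MaxSym 2 (sumsq R 5 ^+ 2)) i j|.
have C_ge0 : 0 <= C by apply: sumr_ge0 => i _; apply: sumr_ge0.
(* On the test tensor the numerator is [- 2 delta] and the denominator at most
   [2 C r^2]; [C + 1] spares the proof that [C] is nonzero. *)
exists (delta / (C + 1)); first by rewrite divr_gt0 // ltr_wpDl.
exists 2%N => // r r2; rewrite sub0r.
have [/sp_setP/(_ _ (@test_tensor_sym R (r - 2)%N)) test _] := sp_max r.
move: test; rewrite test_tensor_choi_lam -/delta => test.
have := slice_form_bound (MaxSym 2 (sumsq R 5 ^+ 2)) (test_tensor R (r - 2)%N).
rewrite -/C => /(le_trans (ler_norm _)) up.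
have := test_tensor_normsq R (r - 2)%N; rewrite subnKC // => norm_le.
have r_gt0 : 0 < r%:R ^+ 2 :> R by rewrite exprn_gt0 // ltr0n (leq_trans _ r2).
rewrite ler_pdivrMr // ler_pdivrMr ?ltr_wpDl //.
have := sp_le0 r; move: test up norm_le.
move: (slice_form _ _) (normsq _) (sp 2 r p) (r%:R ^+ 2) r_gt0 => m N nu q q0.
move=> test up norm_le nu_le0.
have m_le : m <= 2 * (C * q) by apply: le_trans up _; rewrite mulrCA ler_wpM2l.
have : nu * (2 * (C * q)) <= nu * m by rewrite ler_wnM2l.
have : 0 <= - nu * q by rewrite mulr_ge0 ?oppr_ge0 // ltW.
by move=> ? ?; nra.
Qed.
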